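(* A graph $G$ is a half-square of a biconvex bipartite graph (i.e., there is a biconvex bipartite graph $B=(V(G),W,E_B)$ with $G=B^2[V(G)]$) if and only if $G$ is a unit interval graph.
   Context: For a bipartite graph $B=(X,Y,E_B)$, the half-square $B^2[X]$ is the graph on $X$ where two distinct vertices are adjacent iff they have a common neighbor in $Y$. $B$ is $X$-convex if there is a linear ordering of $X$ such that for every $y\in Y$, $N(y)$ is an interval (a set of consecutive elements) of $X$; $Y$-convex is defined symmetrically. $B$ is biconvex if it is both $X$-convex and $Y$-convex. A unit interval graph is an intersection graph of intervals of the real line all of the same length. *)

(* Defs.v *)
From mathcomp Require Import all_boot all_order all_algebra reals.

Set Implicit Arguments.
Unset Strict Implicit.
Unset Printing Implicit Defensive.

Import Order.TTheory GRing.Theory Num.Theory.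
Local Open Scope ring_scope.

Definition simple_graph (V : finType) (e : rel V) : Prop :=
  irreflexive e /\ symmetric e.

(* A bipartite graph (X, Y, E) is given by its edge relation E : X -> Y -> bool;
   E x y means that x in X and y in Y are adjacent. *)
Definition half_square (X Y : finType) (E : X -> Y -> bool) : rel X :=
  fun x x' => (x != x') && [exists y, E x y && E x' y].

Definition linear_ordering (X : finType) (le : rel X) : Prop :=
  [/\ reflexive le, antisymmetric le, transitive le & total le].

Definition is_order_interval (X : finType) (le : rel X) (S : {set X}) : Prop :=
  forall a b c, a \in S -> c \in S -> le a b -> le b c -> b \in S.

Definition left_convex (X Y : finType) (E : X -> Y -> bool) : Prop :=
  exists le : rel X, linear_ordering le /\
    forall y : Y, is_order_interval le [set x | E x y].

Definition right_convex (X Y : finType) (E : X -> Y -> bool) : Prop :=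
  exists le : rel Y, linear_ordering le /\
    forall x : X, is_order_interval le [set y | E x y].

Definition biconvex (X Y : finType) (E : X -> Y -> bool) : Prop :=
  left_convex E /\ right_convex E.

Definition biconvex_half_square (V : finType) (e : rel V) : Prop :=
  exists (W : finType) (E : V -> W -> bool),
    biconvex E /\ e =2 half_square E.

(* The intervals are all closed, as is standard: allowing open and closed
   intervals of the same length together yields a strictly larger class
   (it contains the claw). *)
Definition unit_interval_graph (R : realType) (V : finType) (e : rel V) : Prop :=
  exists a b : V -> R,
    [/\ forall v, a v < b v,
        forall u v, b u - a u = b v - a v &
        forall u v, e u v <->
          u != v /\ exists x : R, x \in `[a u, b u] /\ x \in `[a v, b v]].

(* Main.v *)
Require Import Defs.
From mathcomp Require Import all_boot all_order all_algebra reals.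
From mathcomp Require Import lra.

Set Implicit Arguments.
Unset Strict Implicit.
Unset Printing Implicit Defensive.

Import Order.TTheory GRing.Theory Num.Theory.
Local Open Scope ring_scope.

(** A linear ordering of [X] witnessing convexity is an umbrella ordering of the
    half-square: if [u <= v <= w] and [u], [w] share the neighbour [y], then [v]
    is also adjacent to [y].  Inserting the vertices in this order, one places
    each new vertex to the right of all earlier ones, at distance less than 1
    from its earlier neighbours and more than 1 from its earlier non-neighbours;
    strictness of these inequalities is what leaves room for the next vertex.
    Conversely, if the vertices [v] are represented by the intervals
    [[a v, a v + l]], join [x] to [y], a second copy of a vertex, when
    [a y <= a x <= a y + l]; two vertices at distance at most [l] have the
    copy of the leftmost one as common neighbour. *)

Definition umbrella_free (V : finType) (le e : rel V) : Prop :=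
  forall u v w, le u v -> le v w -> e u w ->
    (u != v -> e u v) /\ (v != w -> e v w).

Lemma half_square_umbrella_free (X Y : finType) (E : X -> Y -> bool)
    (le : rel X) :
  (forall y, is_order_interval le [set x | E x y]) ->
  umbrella_free le (half_square E).
Proof.
move=> convE u v w le_uv le_vw /andP[_ /existsP[y /andP[Euy Ewy]]].
have Evy : E v y.
  have := convE y u v w; rewrite !inE => convy; exact: convy.
by split=> neq; rewrite /half_square neq; apply/existsP; exists y;
   rewrite ?Euy ?Evy ?Ewy.
Qed.

Lemma exists_strict_lower_bound (R : realFieldType) (B : seq R) :
  exists t, {in B, forall b, t < b}.
Proof.
elim: B => [|b B [t tB]]; first by exists 0.
exists (Num.min t (b - 1)) => c; rewrite inE gt_min => /predU1P[->|/tB -> //].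
by rewrite (_ : b - 1 < b) ?orbT //; lra.
Qed.

Lemma exists_between_elt_seq (R : realFieldType) (a : R) (B : seq R) :
  {in B, forall b, a < b} -> exists2 t, a < t & {in B, forall b, t < b}.
Proof.
elim: B => [|b B IH] aB; first by exists (a + 1) => //; lra.
have ab : a < b by apply: aB; rewrite mem_head.
have [c cB|t at_ tB] := IH; first by apply: aB; rewrite inE cB orbT.
exists (Num.min t ((a + b) / 2)) => [|c]; first by rewrite lt_min at_ /=; lra.
rewrite inE gt_min => /predU1P[->|/tB -> //].
by rewrite (_ : (a + b) / 2 < b) ?orbT //; lra.
Qed.

(** Density of the field extends from pairs of points to finite sets, either of which may be empty.
    It supplies the position of a new vertex from finitely many strict constraints. *)
Lemma exists_between_seq (R : realFieldType) (A B : seq R) :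
  {in A & B, forall a b, a < b} ->
  exists t, {in A, forall a, a < t} /\ {in B, forall b, t < b}.
Proof.
elim: A => [|a A IH] AB.
  by have [t tB] := exists_strict_lower_bound B; exists t.
have [c b cA|t [At tB]] := IH; first by apply: AB; rewrite inE cA orbT.
have [a_lt_t|t_le_a] := ltP a t.
  by exists t; split=> // c; rewrite inE => /predU1P[->|/At].
(* Now [a] is at least [t], hence above all of [A], so a point between [a] and [B] suffices. *)
have [b bB|t' at' t'B] := @exists_between_elt_seq R a B.
  by apply: AB; rewrite ?mem_head.
exists t'; split=> // c; rewrite inE => /predU1P[->//|/At ct].
exact: lt_trans ct (le_lt_trans t_le_a at').
Qed.

Section UmbrellaFreeEmbedding.
Variables (R : realFieldType) (V : finType) (le e : rel V).
Hypotheses (le_lin : linear_ordering le) (e_umb : umbrella_free le e).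

Definition strict_unit_embedding (s : seq V) (f : V -> R) : Prop :=
  {in s &, forall u v, le u v -> u != v ->
    [/\ f u < f v, e u v -> f v < f u + 1 & ~~ e u v -> f u + 1 < f v]}.

Lemma strict_unit_embedding_extension (s : seq V) (x : V) (f : V -> R) :
  x \notin s -> {in s, forall v, le v x} -> strict_unit_embedding s f ->
  exists t, {in s, forall v,
    [/\ f v < t, e v x -> t < f v + 1 & ~~ e v x -> f v + 1 < t]}.
Proof.
case: le_lin => _ _ _ le_tot xs s_le_x fP.
have neq_x v : v \in s -> v != x by apply: contraTneq => ->.
(* The strict lower bounds on the position of [x] form [A], the strict upper bounds form [B]. *)
pose A := map f s ++ [seq f v + 1 | v <- s & ~~ e v x].
pose B := [seq f v + 1 | v <- s & e v x].
have [|t [At tB]] := @exists_between_seq R A B.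
  move=> a b; rewrite mem_cat => aA /mapP[u].
  rewrite mem_filter => /andP[eux us] ->.
  case/orP: aA => /mapP[v]; last rewrite mem_filter => /andP[nevx].
    move=> vs ->; have [->|neq_uv] := eqVneq u v; first by lra.
    (* If [u] precedes [v], then [v] lies between the adjacent vertices [u] and [x], so [e u v]
       holds and bounds [f v] by [f u + 1]. *)
    case/orP: (le_tot u v) => le_uv.
      have [euv _] := e_umb le_uv (s_le_x v vs) eux.
      by have [_ + _] := fP u v us vs le_uv neq_uv; apply; apply: euv.
    by have [|+ _ _] := fP v u vs us le_uv; [rewrite eq_sym | lra].
  (* The non-neighbour [v] of [x] must precede the neighbour [u]: otherwise the umbrella property
     would make [v] adjacent to [x]. *)
  move=> vs ->; have neq_uv : u != v by apply: contraNneq nevx => <-.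
  case/orP: (le_tot u v) => le_uv.
    have [_ evx] := e_umb le_uv (s_le_x v vs) eux.
    by rewrite evx ?neq_x in nevx.
  by have [|+ _ _] := fP v u vs us le_uv; [rewrite eq_sym | lra].
exists t => v vs; split=> [|evx|nevx].
- by apply: At; rewrite mem_cat map_f.
- by apply/tB/mapP; exists v; rewrite // mem_filter evx.
- apply: At; rewrite mem_cat; apply/orP; right; apply/mapP.
  by exists v; rewrite // mem_filter nevx.
Qed.

(** The list is decreasing, so its head is the last vertex of the order and structural induction on
    the list adds vertices from left to right. *)
Lemma exists_strict_unit_embedding (s : seq V) :
  uniq s -> pairwise (fun x y => le y x) s ->
  exists f, strict_unit_embedding s f.
Proof.
case: le_lin => _ le_anti _ _.
elim: s => [|x s IH] /=; first by exists (fun=> 0).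
move=> /andP[xs s_uniq] /andP[/allP s_le_x s_pw].
have [f fP] := IH s_uniq s_pw.
have [t tP] := strict_unit_embedding_extension xs s_le_x fP.
exists (fun v => if v == x then t else f v) => u v.
have neq_x w : w \in s -> (w == x) = false.
  by move=> ws; apply: contraNF xs => /eqP <-.
rewrite !inE => /predU1P[->|us] /predU1P[->|vs] le_uv neq_uv.
- by rewrite eqxx in neq_uv.
- have xv : x = v by apply: le_anti; rewrite le_uv s_le_x.
  by rewrite xv eqxx in neq_uv.
- by rewrite eqxx neq_x //; apply: tP.
- by rewrite !neq_x //; apply: fP.
Qed.

End UmbrellaFreeEmbedding.

Lemma unit_intervals_intersectP (R : realFieldType) (l p q : R) : 0 <= l ->
  (exists x, x \in `[p, p + l] /\ x \in `[q, q + l]) <->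
  p <= q + l /\ q <= p + l.
Proof.
move=> l0; split=> [[x []]|[pq qp]].
  by rewrite !in_itv /= => /andP[? ?] /andP[? ?]; split; lra.
exists (Num.max p q); rewrite !in_itv /= !le_max !ge_max !lexx orbT /= pq qp.
by rewrite !lerDl l0.
Qed.

Lemma umbrella_free_unit_interval (R : realType) (V : finType) (le e : rel V) :
  simple_graph e -> linear_ordering le -> umbrella_free le e ->
  unit_interval_graph R e.
Proof.
move=> [e_irr e_sym] le_lin e_umb.
have [le_refl le_anti le_trans le_tot] := le_lin.
pose ge := fun x y => le y x.
have ge_trans : transitive ge by move=> y x z xy yz; apply: le_trans yz xy.
have ge_tot : total ge by move=> x y; apply: le_tot.
have [||f fP] := @exists_strict_unit_embedding R V le e le_lin e_umb
    (sort ge (enum V)).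
- by rewrite sort_uniq enum_uniq.
- by rewrite -sorted_pairwise //; apply: sort_sorted.
(* Distance exactly 1 never occurs, so the strict bounds agree with the closed condition for
   intersecting intervals. *)
have fE u v : le u v -> u != v -> f u < f v /\ e u v = (f v <= f u + 1).
  move=> le_uv neq_uv.
  have [||fuv near far] := fP u v _ _ le_uv neq_uv; rewrite ?mem_sort ?mem_enum //.
  split=> //; case: (boolP (e u v)) => [/near|/far] h; apply/esym.
    exact: ltW.
  by apply: lt_geF.
exists f, (fun v => f v + 1); split=> [v|u v|u v]; [lra | lra |].
rewrite unit_intervals_intersectP ?ler01 //.
have [<-|neq_uv] := eqVneq u v; first by rewrite e_irr; split=> // -[].
case/orP: (le_tot u v) => [le_uv|le_vu].
  have [fuv ->] := fE u v le_uv neq_uv.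
  by split=> [h|[_ []//]]; split=> //; split=> //; lra.
rewrite e_sym; rewrite eq_sym in neq_uv.
have [fuv ->] := fE v u le_vu neq_uv.
by split=> [h|[_ []//]]; split; rewrite 1?eq_sym //; split=> //; lra.
Qed.

(** Several vertices may share a value of [a]; pairing it lexicographically with [enum_rank] breaks
    ties and gives antisymmetry. *)
Lemma exists_compatible_linear_ordering (R : realDomainType) (V : finType)
    (a : V -> R) :
  exists le : rel V, linear_ordering le /\ forall u v, le u v -> a u <= a v.
Proof.
pose key v : R *l 'I_#|V| := (a v, enum_rank v).
have key_inj : injective key by move=> u v [_ /enum_rank_inj].
exists (fun u v => (key u <= key v)%O); split; last first.
  by move=> u v; rewrite /key leEprodlexi => /andP[].
split=> [u|u v|v u w|u v].
- exact: lexx.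
- by move/le_anti/key_inj.
- exact: le_trans.
- exact: le_total.
Qed.

Lemma unit_interval_biconvex_half_square (R : realType) (V : finType)
    (e : rel V) :
  unit_interval_graph R e -> biconvex_half_square e.
Proof.
move=> [a [b [ab len eE]]].
pose E (x y : V) := a y <= a x <= b y.
have [le [le_lin le_a]] := @exists_compatible_linear_ordering R V a.
exists V, E; split.
  split; exists le; split=> // x u v w; rewrite !inE /E => /andP[? ?] /andP[? ?].
    by move=> /le_a ? /le_a ?; apply/andP; split; lra.
  (* Since lengths are equal, right endpoints are ordered like left ones, so the intervals
     containing [a x] are consecutive. *)
  move=> /le_a ? /le_a ?; have := len u v; have := len v w.
  by move=> ? ?; apply/andP; split; lra.
move=> u v; apply/idP/idP => [/eE[neq [x []]]|].
  rewrite !in_itv /= /half_square neq => /andP[? ?] /andP[? ?].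
  have luv := len u v; have abu := ab u; have abv := ab v.
  apply/existsP; case: (leP (a u) (a v)) => ?; [exists u | exists v];
    by rewrite /E; apply/andP; split; apply/andP; split; lra.
case/andP=> neq /existsP[y /andP[/andP[? ?] /andP[? ?]]]; apply/eE; split=> //.
(* Both left endpoints lie in the interval of [y], so they differ by at most the common length and
   the larger one is a common point. *)
have luv := len u v; have luy := len u y; have aby := ab u.
exists (Num.max (a u) (a v)); rewrite !in_itv /= !le_max !ge_max !lexx orbT /=.
by split; apply/andP; split; lra.
Qed.

Theorem theorem4 (R : realType) (V : finType) (e : rel V)
    (He : simple_graph e) :
  biconvex_half_square e <-> unit_interval_graph R e.
Proof.
split; last exact: unit_interval_biconvex_half_square.
move=> [W [E [[[le [le_lin convE]] _] eE]]].
apply: (@umbrella_free_unit_interval R V le e He le_lin).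
move=> u v w; rewrite !eE; exact: half_square_umbrella_free.
Qed.
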